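(* Let $X$ be a Banach space, let $G$ be a semitopological semigroup, and let $I$ be a compact topological space. For each $i\in I$ let $\mathcal{S}_i=\{S_{i,g}:g\in G\}$ be a bounded representation of $G$ on $X$ such that the semigroup $\mathcal{S}_i$ is right amenable, and assume $\sup_{i\in I}\sup_{g\in G}\|S_{i,g}\|<\infty$. Let $\{(A_\alpha^{\mathcal{S}_i})_{\alpha\in\mathcal{A}}:i\in I\}$ be a uniform family of right ergodic nets. Take $x\in X$ and, for $i\in I$, let $Y_i:=\overline{\mathrm{lin}}(\{x\}\cup\{S_{i,g}x:g\in G\})$. Assume that (a) $\mathcal{S}_i$ is mean ergodic on $Y_i$ with mean ergodic projection $P_i$ for each $i\in I$; (b) the map $I\to\mathbb{R}_+$, $i\mapsto\|A_\alpha^{\mathcal{S}_i}x-P_ix\|$, is continuous for each $\alpha\in\mathcal{A}$. Then $$\lim_\alpha\sup_{i\in I}\|A_\alpha^{\mathcal{S}_i}x-P_ix\|=0.$$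
   Context: A semitopological semigroup is a semigroup with a topology for which multiplication is separately continuous. $\mathcal{L}(X)$ denotes the bounded linear operators on $X$, endowed with the strong operator topology. A bounded representation of $G$ on $X$ is a family $\mathcal{S}=\{S_g:g\in G\}\subset\mathcal{L}(X)$ with $\sup_{g\in G}\|S_g\|<\infty$, $S_gS_h=S_{hg}$ for all $g,h\in G$, and $g\mapsto S_gy$ (norm-)continuous for every $y\in X$. Such an $\mathcal{S}$ is regarded as a semigroup of operators under composition with the strong operator topology. $\mathrm{co}\,\mathcal{S}$ is its convex hull and $\overline{\mathrm{co}}\,\mathcal{S}$ the closure of $\mathrm{co}\,\mathcal{S}$ in the strong operator topology. $\overline{\mathrm{lin}}$ is the norm-closed linear span. For a semitopological semigroup $T$, $C_b(T)$ is the space of bounded continuous functions on $T$; a mean is $m\in C_b(T)'$ with $\langle m,\mathbf{1}\rangle=\|m\|=1$, and it is right invariant if $\langle m,R_tf\rangle=\langle m,f\rangle$ for all $t\in T$, $f\in C_b(T)$, where $R_tf(s)=f(st)$. $T$ is right amenable if a right invariant mean on $C_b(T)$ exists. A bounded operator semigroup $\mathcal{S}=\{S_g:g\in G\}$ is mean ergodic if $\overline{\mathrm{co}}\,\mathcal{S}$ contains a zero element $P$ (equivalently, $P\in\overline{\mathrm{co}}\,\mathcal{S}$ with $PS_g=S_gP=P$ for all $g\in G$); $P$ is called its mean ergodic projection. ''$\mathcal{S}_i$ is mean ergodic on $Y_i$'' means that the restricted semigroup $\{S_{i,g}|_{Y_i}:g\in G\}\subset\mathcal{L}(Y_i)$ is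 mean ergodic on the Banach space $Y_i$, and $P_i\in\mathcal{L}(Y_i)$ is the corresponding projection. Let $\mathcal{A}$ be a directed set and let $(A_\alpha^{\mathcal{S}_i})_{\alpha\in\mathcal{A}}\subset\mathcal{L}(X)$ be a net for each $i\in I$. Then $\{(A_\alpha^{\mathcal{S}_i})_{\alpha\in\mathcal{A}}:i\in I\}$ is a uniform family of right ergodic nets if: (1) for all $\alpha\in\mathcal{A}$, $\varepsilon>0$ and $x_1,\dots,x_m\in X$ there exist $g_1,\dots,g_N\in G$ such that for each $i\in I$ there is a convex combination $\sum_{j=1}^Nc_{i,j}S_{i,g_j}\in\mathrm{co}\,\mathcal{S}_i$ with $\sup_{i\in I}\|A_\alpha^{\mathcal{S}_i}x_k-\sum_{j=1}^Nc_{i,j}S_{i,g_j}x_k\|<\varepsilon$ for all $k\in\{1,\dots,m\}$; (2) $\lim_\alpha\sup_{i\in I}\|A_\alpha^{\mathcal{S}_i}y-A_\alpha^{\mathcal{S}_i}S_{i,g}y\|=0$ for all $g\in G$, $y\in X$. *)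

(* Defs.v *)
From HB Require Import structures.
From mathcomp Require Import all_boot all_order all_algebra.
From mathcomp Require Import complex.
From mathcomp Require Import all_classical all_reals ereal topology normedtype.

Set Implicit Arguments.
Unset Strict Implicit.
Unset Printing Implicit Defensive.

Import Order.TTheory GRing.Theory Num.Theory.
Import numFieldNormedType.Exports.

Local Open Scope classical_set_scope.
Local Open Scope complex_scope.
Local Open Scope ring_scope.

(* Banach spaces may be real or complex: K is either R or R[i].  Norms in a
   normedModType K are K-valued; [realpart] turns them into real numbers. *)
Variant scalar_field (R : realType) : numFieldType -> Type :=
| RealScalars : scalar_field R R
| ComplexScalars : scalar_field R R[i].

Definition realpart (R : realType) (K : numFieldType) (s : scalar_field R K) :
    K -> R :=
  match s in scalar_field _ K0 return K0 -> R with
  | RealScalars => id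
  | ComplexScalars => @complex.Re R
  end.

Definition rnorm (R : realType) (K : numFieldType) (s : scalar_field R K)
    (V : normedZmodType K) (v : V) : R := realpart s `|v|.

(* The supremum is taken in [0, +oo], so that it is 0 over an empty index. *)
Definition nnsup (R : realType) (J : Type) (f : J -> \bar R) : \bar R :=
  ereal_sup (0%E |` range f).

Definition semitopological_semigroup (G : topologicalType)
    (mul : G -> G -> G) : Prop :=
  [/\ associative mul,
      forall g, continuous (fun h => mul g h) &
      forall g, continuous (fun h => mul h g)].

Section operators.
Context (R : realType) (K : numFieldType) (s : scalar_field R K).

Definition opnorm (V W : normedModType K) (T : V -> W) : \bar R :=
  ereal_sup [set (rnorm s (T v))%:E | v in [set v : V | rnorm s v <= 1]].

Definition bounded_operator (V W : normedModType K) (T : V -> W) : Prop :=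
  linear T /\ (opnorm T < +oo)%E.

(* For complex scalars, 0 <= c j means that c j is real and nonnegative. *)
Definition convex_weights (n : nat) (c : 'I_n -> K) : Prop :=
  (forall j, 0 <= c j) /\ \sum_(j < n) c j = 1.

(* The topology of {ptws V -> V} induces the strong operator topology. *)
Definition op_co (V : normedModType K) (A : set (V -> V)) :
    set {ptws V -> V} :=
  [set T | exists (n : nat) (c : 'I_n -> K) (U : 'I_n -> V -> V),
     [/\ convex_weights c, forall j, A (U j) &
         T = (fun v => \sum_(j < n) c j *: U j v)]].

Definition op_closed_co (V : normedModType K) (A : set (V -> V)) :
    set {ptws V -> V} :=
  closure (op_co A) `&` [set T | bounded_operator T].

(* P is a zero element of the semigroup [op_closed_co A]. *)
Definition mean_ergodic_projection (V : normedModType K) (A : set (V -> V))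
    (P : V -> V) : Prop :=
  op_closed_co A P /\
  forall T, op_closed_co A T -> P \o T = P /\ T \o P = P.

Definition bounded_continuous (T : topologicalType) : set (T -> K) :=
  [set f | continuous f /\ (nnsup (fun t => (rnorm s (f t))%:E) < +oo)%E].

(* A functional on C_b(T) is a map m on all functions, of which only the
   values on C_b(T) matter. *)
Definition is_mean (T : topologicalType) (m : (T -> K) -> K) : Prop :=
  [/\ forall (a : K) (f h : T -> K),
        bounded_continuous f -> bounded_continuous h ->
        m (fun t => a * f t + h t) = a * m f + m h,
      m (fun=> 1) = 1 &
      ereal_sup [set (rnorm s (m f))%:E | f in [set f : T -> K |
        bounded_continuous f /\ forall t, rnorm s (f t) <= 1]] = 1%E].

Definition right_amenable (T : topologicalType) (mul : T -> T -> T) : Prop :=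
  exists m : (T -> K) -> K, is_mean m /\
    forall (t : T) (f : T -> K), bounded_continuous f ->
      m (fun r => f (mul r t)) = m f.

(* The set A of operators carries the topology induced by {ptws V -> V} and
   the multiplication given by composition. *)
Definition right_amenable_operators (V : normedModType K)
    (A : set {ptws V -> V}) : Prop :=
  exists mulA : set_type A -> set_type A -> set_type A,
    (forall T U, set_val (mulA T U) = set_val T \o set_val U :> (V -> V)) /\
    right_amenable mulA.

Definition bounded_representation (G : topologicalType) (mul : G -> G -> G)
    (V : normedModType K) (S : G -> V -> V) : Prop :=
  [/\ forall g, bounded_operator (S g),
      (nnsup (fun g => opnorm (S g)) < +oo)%E,
      forall g h, S g \o S h = S (mul h g) &
      forall v, continuous (fun g => S g v)].

End operators.

Section closed_span.
Context (K : numFieldType) (V : normedModType K).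

Definition lin_span (A : set V) : set V :=
  [set v | exists (n : nat) (c : 'I_n -> K) (u : 'I_n -> V),
     (forall j, A (u j)) /\ v = \sum_(j < n) c j *: u j].

Definition closed_span (A : set V) : {pred V} :=
  fun v => v \in closure (lin_span A).

Lemma lin_span_submod (A : set V) (a : K) (u v : V) :
  lin_span A u -> lin_span A v -> lin_span A (a *: u + v).
Proof.
move=> [n [c [x [Ax ->]]]] [p [d [y [Ay ->]]]].
exists (n + p)%N,
  (fun j => match fintype.split j with inl k => a * c k | inr k => d k end),
  (fun j => match fintype.split j with inl k => x k | inr k => y k end).
split; first by move=> j; case: (fintype.split j).
rewrite big_split_ord scaler_sumr /=; congr (_ + _).
  by apply: eq_bigr => j _; rewrite (unsplitK (inl j)) scalerA.
by apply: eq_bigr => j _; rewrite (unsplitK (inr j)).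
Qed.

Lemma lin_span0 (A : set V) : lin_span A 0.
Proof.
exists 0%N, (fun=> 0), (fun=> 0); split; last by rewrite big_ord0.
by case.
Qed.

Lemma lin_span_incl (A : set V) : A `<=` lin_span A.
Proof.
move=> v Av; exists 1%N, (fun=> 1), (fun=> v); split => //.
by rewrite big_ord1 scale1r.
Qed.

Lemma closed_span_incl (A : set V) (v : V) : A v -> v \in closed_span A.
Proof. by move=> Av; apply/mem_set/subset_closure/lin_span_incl. Qed.

Lemma closed_span_submod (A : set V) : submod_closed (closed_span A).
Proof.
split; first by apply/mem_set/subset_closure/lin_span0.
move=> a u v /set_mem clu /set_mem clv; apply/mem_set => B nB.
have : (fun z : V * V => a *: z.1 + z.2) @ (nbhs u, nbhs v) --> a *: u + v.
  apply: cvgD; last exact: cvg_snd.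
  by apply: cvgZl_tmp; exact: cvg_fst.
move=> /(_ B nB) [[/= C D] [/clu [u' [Su' Cu']] /clv [v' [Sv' Dv']]] sCD].
exists (a *: u' + v'); split; first exact: lin_span_submod.
exact: (sCD (u', v')).
Qed.

HB.instance Definition _ (A : set V) :=
  GRing.isSubmodClosed.Build K V (closed_span A)
    (GRing.submod_closed_semi (closed_span_submod A)).

(* The closed linear span of A as a normed space, with the norm of V. *)
Definition span_space (A : set V) : Type := {v : V | v \in closed_span A}.

HB.instance Definition _ (A : set V) := SubChoice.on (span_space A).
HB.instance Definition _ (A : set V) :=
  [SubChoice_isSubLmodule of span_space A by <:].

Definition span_norm (A : set V) (y : span_space A) : K := `|val y|.

Lemma span_normD (A : set V) (y z : span_space A) :
  span_norm (y + z) <= span_norm y + span_norm z.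
Proof. exact: ler_normD. Qed.

Lemma span_normZ (A : set V) (a : K) (y : span_space A) :
  span_norm (a *: y) = `|a| * span_norm y.
Proof. exact: normrZ. Qed.

Lemma span_norm_eq0 (A : set V) (y : span_space A) : span_norm y = 0 -> y = 0.
Proof. by move=> /normr0_eq0 y0; apply/val_inj. Qed.

HB.instance Definition _ (A : set V) := Lmodule_isNormed.Build K (span_space A)
  (@span_normD A) (@span_normZ A) (@span_norm_eq0 A).

Definition restricted_operators (G : Type) (S : G -> V -> V) (A : set V) :
    set (span_space A -> span_space A) :=
  [set T | exists g, forall y, val (T y) = S g (val y)].

Definition orbit_set (G : Type) (S : G -> V -> V) (x : V) : set V :=
  [set x] `|` [set S g x | g in [set: G]].

Lemma orbit_set_base (G : Type) (S : G -> V -> V) (x : V) :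
  x \in closed_span (orbit_set S x).
Proof. by apply: closed_span_incl; left. Qed.

Definition orbit_space (G : Type) (S : G -> V -> V) (x : V) : normedModType K :=
  span_space (orbit_set S x).

Definition orbit_base (G : Type) (S : G -> V -> V) (x : V) : orbit_space S x :=
  exist _ x (orbit_set_base S x).

End closed_span.
Arguments restricted_operators {K V G} S A.

Definition directed_set (d : Order.disp_t) (Lam : preorderType d) : Prop :=
  inhabited Lam /\
  forall a b : Lam, exists c : Lam, (a <= c)%O /\ (b <= c)%O.

(* Convergence along this filter is convergence of nets indexed by Lam. *)
Definition net_filter (d : Order.disp_t) (Lam : preorderType d) :
    set_system Lam :=
  [set B | exists a, forall b, (a <= b)%O -> B b].
Arguments net_filter {d} Lam.

Definition uniform_right_ergodic_nets (R : realType) (K : numFieldType)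
    (s : scalar_field R K) (X : normedModType K) (G I : Type)
    (S : I -> G -> X -> X) (d : Order.disp_t) (Lam : preorderType d)
    (A : I -> Lam -> X -> X) : Prop :=
  [/\ forall i a, bounded_operator s (A i a),
      forall (a : Lam) (eps : R) (m : nat) (x : 'I_m -> X), 0 < eps ->
        exists (N : nat) (g : 'I_N -> G) (c : I -> 'I_N -> K),
          (forall i, convex_weights (c i)) /\
          forall k : 'I_m,
            (nnsup (fun i => (rnorm s (A i a (x k) -
               \sum_(j < N) c i j *: S i (g j) (x k)))%:E) < eps%:E)%E &
      forall (g : G) (y : X),
        nnsup (fun i => (rnorm s (A i a y - A i a (S i g y)))%:E)
          @[a --> net_filter Lam] --> 0%E].

(* Main.v *)
Require Import Defs.
From mathcomp Require Import all_boot all_order all_algebra.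
From mathcomp Require Import complex lra.
From mathcomp Require Import all_classical all_reals ereal topology normedtype.

Import Order.TTheory GRing.Theory Num.Theory.
Import numFieldNormedType.Exports.

Local Open Scope classical_set_scope.
Local Open Scope ring_scope.

(** Fix an index [i], let [M] bound the norms of all [S i g], and write [p i]
    for [P_i x].  The operators [A i a] are pointwise limits of convex
    combinations of the [S i g], hence have norm at most [M] and fix every
    [S i]-invariant vector, in particular [p i].  If [p i] is within [e] of a
    convex combination [\sum_j c j *: S i (g j) x], then
<<
      A i a x - p i = A i a (x - p i)
                    = \sum_j c j *: A i a (x - S i (g j) x) - A i a (error)
>>
    has norm at most [M * e + e'] as soon as each [A i a (x - S i (g j) x)]
    has norm at most [e'] ([ergodic_net_error]); asymptotic invariance
    provides this for all large [a], uniformly in [i]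
    ([ergodic_net_asymptotic]).

    The error bound is used twice.  Since [p i] lies in the closed convex hull
    of the orbit of [x] ([mean_ergodic_approx]), it first gives convergence
    for each single index, so at every [i0] some [A i0 a0 x] is close to
    [p i0].  By continuity of [i |-> ||A i a0 x - p i||] the same [a0] works on
    a neighbourhood of [i0].  There [A i a0 x], hence [p i], is close to convex
    combinations that involve the same finitely many [g j] for all [i]
    ([ergodic_net_convex]).  The second use of the error bound therefore gives
    an estimate that holds for all large [a] simultaneously for all [i] near
    [i0], and compactness makes it global.  *)

(** * Real-valued norms *)

Section real_norm.
Context (R : realType) (K : numFieldType) (s : scalar_field R K).
Set Implicit Arguments.
Unset Strict Implicit.

Lemma realpartD (a b : K) :
  realpart s (a + b) = realpart s a + realpart s b.
Proof. by case: s a b => // -[? ?] [? ?]. Qed.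

Lemma realpart_le (a b : K) : a <= b -> realpart s a <= realpart s b.
Proof. by case: s a b => // a b; rewrite lecE => /andP[]. Qed.

Lemma realpartM (a b : K) : 0 <= a ->
  realpart s (a * b) = realpart s a * realpart s b.
Proof.
case: s a b => // -[a a'] [b b']; rewrite lecE /= => /andP[/eqP -> _].
by rewrite mul0r subr0.
Qed.

Lemma realpart0 : realpart s 0 = 0. Proof. by case: s. Qed.

Lemma realpart1 : realpart s 1 = 1. Proof. by case: s. Qed.

Lemma realpart_sum (n : nat) (c : 'I_n -> K) :
  realpart s (\sum_j c j) = \sum_j realpart s (c j).
Proof. exact: (big_morph _ realpartD realpart0). Qed.

(** The real numbers sit inside the scalars as a section of [realpart] over
    which nonnegative scalars are determined, so norm inequalities may be
    read in [R] or in [K]. *)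
Lemma realpart_section : exists r : R -> K,
  [/\ forall e, realpart s (r e) = e,
      forall e, 0 < e -> 0 < r e,
      forall a, 0 <= a -> r (realpart s a) = a &
      forall a e, 0 <= a -> (a < r e) = (realpart s a < e)].
Proof.
case: s => /=; first by exists id.
exists (fun e => e%:C%C); split => [//|e||].
- by rewrite ltcE /= eqxx.
- by move=> [a b]; rewrite lecE /= => /andP[/eqP -> _].
- by move=> [a b] e; rewrite lecE ltcE /= => /andP[/eqP -> _]; rewrite eqxx.
Qed.

Section space.
Context (V : normedModType K).
Implicit Types u v : V.

Lemma rnorm_ge0 v : 0 <= rnorm s v.
Proof. by rewrite -realpart0; apply: realpart_le. Qed.

Lemma rnormD u v : rnorm s (u + v) <= rnorm s u + rnorm s v.
Proof. by rewrite -realpartD; apply: realpart_le; apply: ler_normD. Qed.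

Lemma rnormN v : rnorm s (- v) = rnorm s v.
Proof. by rewrite /rnorm normrN. Qed.

Lemma rnormZ (c : K) v : rnorm s (c *: v) = realpart s `|c| * rnorm s v.
Proof. by rewrite /rnorm normrZ realpartM. Qed.

Lemma rnorm0 : rnorm s (0 : V) = 0.
Proof. by rewrite /rnorm normr0 realpart0. Qed.

Lemma rnorm0_eq0 v : rnorm s v = 0 -> v = 0.
Proof.
have [r [_ _ rK _]] := realpart_section.
move=> v0; apply/normr0_eq0; rewrite -(rK `|v|) // [realpart _ _]v0.
by rewrite -realpart0 rK.
Qed.

Lemma rnorm_small_eq0 v : (forall e : R, 0 < e -> rnorm s v < e) -> v = 0.
Proof.
move=> small; apply/rnorm0_eq0/eqP; rewrite eq_le rnorm_ge0 andbT.
by apply/ler_addgt0Pl => e e0; rewrite addr0; apply/ltW/small.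
Qed.

(** With [nbhs_rnorm], the real-valued norm induces the topology, which is
    defined from balls with radii in [K]. *)
Lemma near_rnorm v (e : R) : 0 < e -> \forall u \near v, rnorm s (v - u) < e.
Proof.
have [r [_ r0 _ rlt]] := realpart_section.
move=> /r0 re; apply/nbhs_normP; exists (r e) => // u /=.
by rewrite rlt.
Qed.

Lemma nbhs_rnorm v (B : set V) : nbhs v B ->
  exists2 e : R, 0 < e & forall u, rnorm s (v - u) < e -> B u.
Proof.
have [r [rK _ rV rlt]] := realpart_section.
move=> /nbhs_normP [k /= k0 kB]; exists (realpart s k).
  rewrite lt_neqAle -{2}realpart0 realpart_le ?ltW // andbT eq_sym.
  apply/eqP => kn; have := k0.
  by rewrite -(rV k (ltW k0)) kn -realpart0 rV // ltxx.
by move=> u; rewrite /rnorm -rlt // rV ?ltW //; exact: kB.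
Qed.

Lemma rnorm_convex (n : nat) (c : 'I_n -> K) (u : 'I_n -> V) (e : R) :
  convex_weights c -> (forall j, rnorm s (u j) <= e) ->
  rnorm s (\sum_j c j *: u j) <= e.
Proof.
move=> [c0 c1] ue; apply: (@le_trans _ _ (\sum_j realpart s (c j) * e)).
  elim/big_ind2 : _ => [|a a' b b' ha hb|j _]; first by rewrite rnorm0.
    exact: le_trans (rnormD _ _) (lerD ha hb).
  rewrite rnormZ ger0_norm //; apply: ler_wpM2l => //.
  by rewrite -realpart0 realpart_le.
by rewrite -mulr_suml -realpart_sum c1 realpart1 mul1r.
Qed.

Lemma convex_sub (n : nat) (c : 'I_n -> K) (u : 'I_n -> V) v :
  convex_weights c ->
  v - \sum_j c j *: u j = \sum_j c j *: (v - u j).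
Proof.
move=> [_ c1]; under [RHS]eq_bigr do rewrite scalerBr.
by rewrite sumrB -scaler_suml c1 scale1r.
Qed.

End space.

(** * Bounded operators *)

Section linear_maps.
Context (V W : normedModType K) (T : V -> W).
Hypothesis linT : linear T.

Lemma lin0 : T 0 = 0.
Proof. by have := linT (-1) 0 0; rewrite !scaleN1r !addNr. Qed.

Lemma linZ c v : T (c *: v) = c *: T v.
Proof. by rewrite -[c *: v]addr0 linT lin0 addr0. Qed.

Lemma linB u v : T (u - v) = T u - T v.
Proof. by rewrite addrC -scaleN1r linT scaleN1r addrC. Qed.

Lemma lin_sum (n : nat) (c : 'I_n -> K) (u : 'I_n -> V) :
  T (\sum_j c j *: u j) = \sum_j c j *: T (u j).
Proof.
have linD a b : T (a + b) = T a + T b.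
  by rewrite -[a]scale1r linT !scale1r.
by rewrite (big_morph _ linD lin0); apply: eq_bigr => j _; exact: linZ.
Qed.

Lemma opnorm_rnorm (M : R) v : (opnorm s T <= M%:E)%E ->
  rnorm s (T v) <= M * rnorm s v.
Proof.
have [r [rK r0 rV _]] := realpart_section => TM.
(* v is rescaled to norm 1, which a null vector does not allow *)
have [v0|vn0] := eqVneq (rnorm s v) 0.
  by rewrite (rnorm0_eq0 v0) lin0 !rnorm0 mulr0.
have vgt0 : 0 < rnorm s v by rewrite lt_neqAle eq_sym vn0 rnorm_ge0.
have igt0 : 0 < (rnorm s v)^-1 by rewrite invr_gt0.
have inorm : realpart s `|r (rnorm s v)^-1| = (rnorm s v)^-1.
  by rewrite gtr0_norm ?rK // r0.
pose u := r (rnorm s v)^-1 *: v.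
have u1 : rnorm s u <= 1 by rewrite rnormZ inorm mulVf.
have : rnorm s (T u) <= M.
  rewrite -lee_fin; apply: le_trans TM; apply: ereal_sup_ubound.
  by exists u.
by rewrite linZ rnormZ inorm mulrC ler_pdivrMr.
Qed.

End linear_maps.

End real_norm.

(** * Nets and suprema *)

Section suprema.
Context (R : realType).
Set Implicit Arguments.
Unset Strict Implicit.

Lemma le_nnsup (J : Type) (f : J -> \bar R) (j : J) : (f j <= nnsup f)%E.
Proof. by apply: ereal_sup_ubound; right; exists j. Qed.

Lemma nnsup_le (J : Type) (f : J -> \bar R) (M : \bar R) :
  (0 <= M)%E -> (forall j, f j <= M)%E -> (nnsup f <= M)%E.
Proof. by move=> M0 fM; apply: ge_ereal_sup => _ [->//|[j _ <-]]. Qed.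

Lemma nnsup_ge0 (J : Type) (f : J -> \bar R) : (0 <= nnsup f)%E.
Proof. by apply: ereal_sup_ubound; left. Qed.

Lemma nnsup_cvg0P (J T : Type) (F : set_system T) (f : T -> J -> R) :
  Filter F ->
  (nnsup (fun j => (f a j)%:E) @[a --> F] --> 0%E) <->
  (forall e : R, 0 < e -> \forall a \near F, forall j, f a j < e).
Proof.
move=> FF; split=> [f0 e e0|f0 B].
  have /f0 : nbhs 0%E [set y : \bar R | (y < e%:E)%E].
    exact: (@nbhs_open_ereal_lt _ _ (fun=> e)).
  apply: (@filterS _ F FF) => a /= fe j; rewrite -lte_fin.
  by apply: le_lt_trans fe; exact: (le_nnsup (fun j => (f a j)%:E)).
move=> /nbhs_normP [e /= e0 eB].
have /f0 : 0 < e / 2 by rewrite divr_gt0.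
apply: filterS => a /= fe.
have : (nnsup (fun j => (f a j)%:E) <= (e / 2)%:E)%E.
  by apply: nnsup_le => [|j]; rewrite lee_fin ltW // divr_gt0.
have := nnsup_ge0 (fun j => (f a j)%:E).
case: nnsup => // t; rewrite !lee_fin => t0 te.
apply: eB; rewrite /= sub0r normrN ger0_norm //.
by apply: le_lt_trans te _; rewrite ltr_pdivrMr // ltr_pMr // ltr1n.
Qed.

(** The error bound below is affine in the accuracies; this chooses them. *)
Lemma small_slope (M e : R) : 0 <= M -> 0 < e ->
  exists2 k : R, 0 < k & M * (k + k) + k < e.
Proof.
move=> M0 e0; have c0 : 0 < 2 * M + 2 by rewrite ltr_wpDl ?mulr_ge0.
have k0 : 0 < e / (2 * M + 2) by exact: divr_gt0.
exists (e / (2 * M + 2)) => //.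
have : e / (2 * M + 2) * (2 * M + 2) = e by rewrite divfK // gt_eqF.
set k := e / _ in k0 * => ke; lra.
Qed.

Lemma net_filter_filter (d : Order.disp_t) (Lam : preorderType d) :
  directed_set Lam -> Filter (@net_filter d Lam).
Proof.
move=> [[a0] dir]; split; first by exists a0.
  move=> B C [a aB] [b bC]; have [c [ac bc]] := dir a b.
  by exists c => e ce; split; [apply/aB/(le_trans ac)|apply/bC/(le_trans bc)].
by move=> B C BC [a aB]; exists a => b /aB /BC.
Qed.

End suprema.

(** * The mean ergodic projection on the orbit of a vector *)

Section orbit.
Context (R : realType) (K : numFieldType) (s : scalar_field R K).
Context (X : normedModType K) (G : topologicalType) (mul : G -> G -> G).
Context (S : G -> X -> X) (x : X).
Hypothesis repS : bounded_representation s mul S.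
Set Implicit Arguments.
Unset Strict Implicit.

Lemma representation_linear g : linear (S g).
Proof. by have [bS _ _ _] := repS; case: (bS g). Qed.

Lemma representation_bounded :
  exists2 M : R, 0 <= M & forall g, (opnorm s (S g) <= M%:E)%E.
Proof.
have [_ + _ _] := repS; have := nnsup_ge0 (fun g => opnorm s (S g)).
have := @le_nnsup _ _ (fun g => opnorm s (S g)).
case: nnsup => // M leM; rewrite lee_fin => M0 _.
by exists M.
Qed.

(** [S g] maps generators of the span to generators, as [x] goes to [S g x] and
    [S h x] to [S (mul h g) x]; continuity extends this to the closure. *)
Lemma orbit_span_stable g (y : X) :
  y \in closed_span (orbit_set S x) -> S g y \in closed_span (orbit_set S x).
Proof.
have [M M0 SM] := representation_bounded.
have [_ _ Smul _] := repS.
move=> /set_mem cly; apply/mem_set => B /(nbhs_rnorm s) [e e0 eB].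
have M1 : 0 < M + 1 by rewrite ltr_wpDl.
have /(near_rnorm s y) : 0 < e / (M + 1) by rewrite divr_gt0.
move=> /cly [_ [[n [c [u [uA ->]]]] yu]].
exists (S g (\sum_(j < n) c j *: u j)); split.
  exists n, c, (fun j => S g (u j)); split.
    move=> j; case: (uA j) => [->|[h _ <-]]; right; first by exists g.
    by exists (mul h g) => //; rewrite -Smul.
  exact: (lin_sum (representation_linear g)).
apply: eB; rewrite -(linB (representation_linear g)).
apply: le_lt_trans (opnorm_rnorm (representation_linear g) _ (SM g)) _.
rewrite ltr_pdivlMr // in yu; apply: le_lt_trans yu.
by rewrite mulrC ler_wpM2l ?rnorm_ge0 // lerDl.
Qed.

Lemma restricted_operator g : exists T : orbit_space S x -> orbit_space S x,
  (forall y, val (T y) = S g (val y)) /\ bounded_operator s T.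
Proof.
pose T (y : orbit_space S x) : orbit_space S x :=
  exist _ (S g (val y)) (orbit_span_stable g (valP y)).
exists T; split=> //; split.
  by move=> a y z; apply/val_inj; exact: (representation_linear g).
have [M _ SM] := representation_bounded.
apply: (@le_lt_trans _ _ M%:E); last exact: ltry.
apply: le_trans (SM g); apply: ereal_sup_le => _ [y y1 <-].
by exists (val y).
Qed.

Variable P : orbit_space S x -> orbit_space S x.
Hypothesis ergP :
  mean_ergodic_projection s (restricted_operators S (orbit_set S x)) P.

(** The restriction of [S g] belongs to the closed convex hull, of which [P]
    is a zero element. *)
Lemma mean_ergodic_fixed g y : S g (val (P y)) = val (P y).
Proof.
have [T [TS bT]] := restricted_operator g; have [_ zeroP] := ergP.
have [|_ TP] := zeroP T.
  split=> //; apply: subset_closure.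
  exists 1%N, (fun=> 1), (fun=> T); split.
  - by split=> //; rewrite big_ord1.
  - by move=> _; exists g.
  - by apply/funext => v; rewrite big_ord1 scale1r.
by rewrite -TS -[in RHS]TP.
Qed.

(** Evaluation at [x] is continuous for the strong operator topology, so it
    maps the closed convex hull of the operators into that of the orbit. *)
Lemma mean_ergodic_approx (e : R) : 0 < e ->
  exists (N : nat) (g : 'I_N -> G) (c : 'I_N -> K), convex_weights c /\
    rnorm s (val (P (orbit_base S x)) - \sum_j c j *: S (g j) x) < e.
Proof.
move=> e0; have [[clP _] _] := ergP.
have /clP : nbhs (P : {ptws orbit_space S x -> orbit_space S x})
    [set T | rnorm s (P (orbit_base S x) - T (orbit_base S x)) < e].
  apply: (@proj_continuous _ (fun=> orbit_space S x) (orbit_base S x) P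
    [set u | rnorm s (P (orbit_base S x) - u) < e]).
  exact: near_rnorm.
move=> [_ [[n [c [U [cc UA ->]]]] /= PU]].
have [g gU] := choice UA.
exists n, g, c; split=> //.
suff -> : val (P (orbit_base S x)) - \sum_j c j *: S (g j) x =
    val (P (orbit_base S x) - \sum_j c j *: U j (orbit_base S x)) by [].
rewrite [RHS]raddfB; congr (_ - _).
rewrite [RHS]raddf_sum; apply: eq_bigr => j _.
exact: (congr1 ( *:%R (c j)) (esym (gU j (orbit_base S x)))).
Qed.

End orbit.

(** * Uniform families of right ergodic nets *)

Section ergodic_nets.
Context (R : realType) (K : numFieldType) (s : scalar_field R K).
Context (X : normedModType K) (G I : Type) (S : I -> G -> X -> X).
Context (d : Order.disp_t) (Lam : preorderType d) (A : I -> Lam -> X -> X).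
Hypothesis hA : uniform_right_ergodic_nets s S A.
Set Implicit Arguments.
Unset Strict Implicit.

Lemma ergodic_net_linear i a : linear (A i a).
Proof. by have [bA _ _] := hA; case: (bA i a). Qed.

(** The elements [g j] and their number do not depend on [i]: this is what
    makes local estimates in [i] possible. *)
Lemma ergodic_net_convex a (y : X) (e : R) : 0 < e ->
  exists (N : nat) (g : 'I_N -> G) (c : I -> 'I_N -> K), forall i,
    convex_weights (c i) /\
    rnorm s (A i a y - \sum_j c i j *: S i (g j) y) < e.
Proof.
move=> e0; have [_ cA _] := hA.
have [N [g [c [cc cA']]]] := cA a e 1%N (fun=> y) e0.
exists N, g, c => i; split=> //.
rewrite -lte_fin; apply: le_lt_trans (cA' ord0).
exact: (le_nnsup (fun i => (rnorm s (A i a y -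
  \sum_(j < N) c i j *: S i (g j) y))%:E)).
Qed.

Lemma ergodic_net_bound (M : R) i a (y : X) :
  (forall g, rnorm s (S i g y) <= M * rnorm s y) ->
  rnorm s (A i a y) <= M * rnorm s y.
Proof.
move=> SM; apply/ler_addgt0Pl => e e0.
have [N [g [c /(_ i)[cc Ae]]]] := ergodic_net_convex a y e0.
rewrite -[A i a y](subrK (\sum_j c i j *: S i (g j) y)).
apply: le_trans (rnormD _ _ _) (lerD (ltW Ae) _).
exact: rnorm_convex.
Qed.

Lemma ergodic_net_fixed i a (y : X) :
  (forall g, S i g y = y) -> A i a y = y.
Proof.
move=> Sy; apply/eqP; rewrite -subr_eq0; apply/eqP.
apply: (@rnorm_small_eq0 _ _ s) => e e0.
have [N [g [c /(_ i)[[_ c1] Ae]]]] := ergodic_net_convex a y e0.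
move: Ae; under eq_bigr do rewrite Sy.
by rewrite -scaler_suml c1 scale1r.
Qed.

Lemma ergodic_net_asymptotic (hLam : directed_set Lam) (N : nat)
    (g : 'I_N -> G) (y : X) (e : R) : 0 < e ->
  \forall a \near @net_filter d Lam, forall i j,
    rnorm s (A i a (y - S i (g j) y)) < e.
Proof.
move=> e0; have FLam := net_filter_filter hLam; have [_ _ rA] := hA.
have : \forall a \near @net_filter d Lam, forall j i,
    rnorm s (A i a (y - S i (g j) y)) < e.
  apply: filter_forall => j.
  have /nnsup_cvg0P/(_ e e0) := rA (g j) y.
  by apply: filterS => a Ae i; rewrite linB //; exact: ergodic_net_linear.
by apply: filterS => a Ae i j; exact: Ae.
Qed.

(** Splits [x - p] into [\sum_j c j *: (x - S i (g j) x)], which the nets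
    annihilate asymptotically, and a remainder, on which they are bounded. *)
Lemma ergodic_net_error i a (M : R) (x p : X) (N : nat) (g : 'I_N -> G)
    (c : 'I_N -> K) (e e' : R) :
  0 <= M -> (forall h y, rnorm s (S i h y) <= M * rnorm s y) ->
  (forall h, S i h p = p) ->
  convex_weights c -> rnorm s (p - \sum_j c j *: S i (g j) x) <= e ->
  (forall j, rnorm s (A i a (x - S i (g j) x)) <= e') ->
  rnorm s (A i a x - p) <= M * e + e'.
Proof.
move=> M0 SM Sp cc pe Ae.
have linA := @ergodic_net_linear i a.
rewrite -[X in rnorm s (_ - X)](ergodic_net_fixed a Sp) -linB //.
have -> : x - p = \sum_j c j *: (x - S i (g j) x) -
    (p - \sum_j c j *: S i (g j) x).
  by rewrite -convex_sub // opprB addrA subrK.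
rewrite linB // addrC; apply: le_trans (rnormD _ _ _) (lerD _ _).
  rewrite rnormN; apply: le_trans (ergodic_net_bound _ (SM^~ _)) _.
  by rewrite ler_wpM2l.
by rewrite lin_sum //; apply: rnorm_convex.
Qed.

End ergodic_nets.

(** * Uniform convergence over a compact index space *)

Theorem theorem2p4 (R : realType) (K : numFieldType) (s : scalar_field R K)
    (X : completeNormedModType K)
    (G : topologicalType) (mul : G -> G -> G)
    (hG : semitopological_semigroup mul)
    (I : topologicalType) (hI : compact [set: I])
    (S : I -> G -> X -> X)
    (hS : forall i, bounded_representation s mul (S i))
    (hSamenable : forall i,
       right_amenable_operators s (range (S i) : set {ptws X -> X}))
    (hSbounded : (nnsup (fun i => nnsup (fun g => opnorm s (S i g))) < +oo)%E)
    (d : Order.disp_t) (Lam : preorderType d) (hLam : directed_set Lam)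
    (A : I -> Lam -> X -> X)
    (hA : uniform_right_ergodic_nets s S A)
    (x : X)
    (P : forall i, orbit_space (S i) x -> orbit_space (S i) x)
    (ha : forall i, mean_ergodic_projection s
       (restricted_operators (S i) (orbit_set (S i) x)) (P i))
    (hb : forall a : Lam, continuous
       (fun i : I => rnorm s (A i a x - val (P i (orbit_base (S i) x))))) :
  nnsup (fun i : I =>
      (rnorm s (A i a x - val (P i (orbit_base (S i) x))))%:E)
    @[a --> net_filter Lam] --> 0%E.
Proof.
have FLam := net_filter_filter hLam.
have [M M0 SM] : exists2 M : R, 0 <= M & forall i g y,
    rnorm s (S i g y) <= M * rnorm s y.
  have := nnsup_ge0 (fun i => nnsup (fun g => opnorm s (S i g))).
  have := le_nnsup (fun i => nnsup (fun g => opnorm s (S i g))).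
  case: nnsup hSbounded => // M _ leM; rewrite lee_fin => M0.
  exists M => // i g y; apply: opnorm_rnorm.
    exact: (representation_linear (hS i)).
  by apply: le_trans (leM i); exact: (le_nnsup (fun g => opnorm s (S i g))).
pose p i := val (P i (orbit_base (S i) x)).
have Sp i g : S i g (p i) = p i by exact: (mean_ergodic_fixed (hS i) (ha i)).
apply/nnsup_cvg0P => e e0.
have near_setT : \forall a \near net_filter Lam,
    [set: I] `<=` [set i | rnorm s (A i a x - p i) < e].
  have [k k0 ke] := small_slope M0 e0.
  apply: (compact_near_coveringP _).1 hI _ _ _ FLam _ => i0 _.
  (* at i0 alone, the convex combination close to p i0 may depend on i0 *)
  have [a0 Aa0] : exists a0, rnorm s (A i0 a0 x - p i0) < k.
    have [k' k'0 k'k] := small_slope M0 k0.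
    have [N [g [c [cc pk']]]] := mean_ergodic_approx (ha i0) k'0.
    have [a0 Aa0] := ergodic_net_asymptotic hA hLam g x k'0.
    exists a0; apply: le_lt_trans k'k.
    apply: (@ergodic_net_error _ _ _ _ _ _ _ _ _ _ hA _ _ _ _ _ _ g c) => //.
    - by rewrite ltW // (lt_trans pk') // ltrDl.
    - by move=> j; apply/ltW/Aa0.
  have [N [g [c cA]]] := ergodic_net_convex hA a0 x k0.
  have near_i : \forall i \near i0, rnorm s (A i a0 x - p i) < k.
    exact: (hb a0 i0 _ (lt_nbhsl Aa0)).
  have near_a := ergodic_net_asymptotic hA hLam g x k0.
  exists ([set i | rnorm s (A i a0 x - p i) < k],
    [set a | forall i j, rnorm s (A i a (x - S i (g j) x)) < k]) => //=.
  move=> [i a] [/= Aik Aak]; have [cc cAi] := cA i.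
  apply: le_lt_trans ke.
  apply: (@ergodic_net_error _ _ _ _ _ _ _ _ _ _ hA _ _ _ _ _ _ g (c i)) => //.
  (* p i is compared with the convex combination through A i a0 x *)
  - rewrite -[p i](subrK (A i a0 x)) -addrA.
    apply: le_trans (rnormD _ _ _) (lerD _ (ltW cAi)).
    by rewrite -rnormN opprB ltW.
  - by move=> j; apply/ltW/Aak.
by apply: filterS near_setT => a Ae i; exact: Ae.
Qed.
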